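(* For any integers $0\le k_1\le k\le n/2$, we have $E_{k}(n)\le E_{k_1}(n-2(k-k_1))+7$.
   Context: $[n]=\{1,\dots,n\}$ and $\binom{[n]}{k}$ is the set of $k$-element subsets of $[n]$. For integers $0\le k\le n$ and a function $f:\binom{[n]}{k}\to\{0,1\}$, the deterministic query complexity $D_k(f)$ is the minimum number $q$ such that there is a deterministic adaptive algorithm which, for every $A\in\binom{[n]}{k}$ (with $f$, $n$, $k$ known, $A$ unknown), correctly computes $f(A)$ using at most $q$ queries, where a query is an element $i\in[n]$ and its answer is whether $i\in A$ or $i\notin A$. Let $D_k(n)=\max\{D_k(f) : f:\binom{[n]}{k}\to\{0,1\}\}$ and $E_k(n)=n-D_k(n)$. *)

(* Defs.v *)
From mathcomp Require Import all_boot.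
From mathcomp Require Import boolp.

Set Implicit Arguments.
Unset Strict Implicit.
Unset Printing Implicit Defensive.

(* The ground set [n] is 'I_n. *)
Definition ksubset (n k : nat) := {A : {set 'I_n} | #|A| == k}.

(* Deterministic adaptive query algorithms: [Query i t1 t0] asks whether i
   belongs to the unknown set and continues with t1 on "yes", t0 on "no". *)
Inductive algorithm (n : nat) : Type :=
| Output of bool
| Query of 'I_n & algorithm n & algorithm n.

Arguments Output {n} _.

Fixpoint run (n : nat) (t : algorithm n) (A : {set 'I_n}) : bool :=
  match t with
  | Output b => b
  | Query i t1 t0 => if i \in A then run t1 A else run t0 A
  end.

Fixpoint queries (n : nat) (t : algorithm n) (A : {set 'I_n}) : nat :=
  match t with
  | Output _ => 0
  | Query i t1 t0 => (if i \in A then queries t1 A else queries t0 A).+1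
  end.

Definition computable_within (n k : nat) (f : {ffun ksubset n k -> bool})
    (q : nat) : Prop :=
  exists t : algorithm n,
    forall A : ksubset n k, run t (val A) = f A /\ queries t (val A) <= q.

Section QueryAll.
Variables (n k : nat) (f : {ffun ksubset n k -> bool}).

Fixpoint query_all (s : seq 'I_n) (B : {set 'I_n}) : algorithm n :=
  match s with
  | [::] => Output (if insub B is Some A then f A else false)
  | i :: s' => Query i (query_all s' (i |: B)) (query_all s' B)
  end.

Lemma queries_query_all s B A : queries (query_all s B) A = size s.
Proof. by elim: s B => //= i s IHs B; case: ifP => _; rewrite IHs. Qed.

Lemma run_query_all s (B : {set 'I_n}) (A : ksubset n k) :
  B \subset val A -> (forall i, i \in val A -> (i \in s) || (i \in B)) ->
  run (query_all s B) (val A) = f A.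
Proof.
elim: s B => [|i s IHs] B sBA sAB /=.
  suff -> : B = val A by rewrite valK.
  by apply/eqP; rewrite eqEsubset sBA; apply/subsetP => i /sAB.
case: ifP => iA; apply: IHs => //.
- by rewrite subUset sub1set iA.
- by move=> j /sAB; rewrite !inE; case: (j == i); rewrite ?orbT.
- move=> j jA; have := sAB j jA; rewrite inE.
  by case: eqP => // eji; rewrite -eji jA in iA.
Qed.

Lemma computable_within_n : computable_within f n.
Proof.
exists (query_all (enum 'I_n) set0) => A; split.
  by apply: run_query_all => [|i _]; rewrite ?sub0set // mem_enum.
by rewrite queries_query_all size_enum_ord.
Qed.

Lemma computable_ex : exists q, `[< computable_within f q >].
Proof. by exists n; apply/asboolP/computable_within_n. Qed.

End QueryAll.

Definition query_complexity (n k : nat) (f : {ffun ksubset n k -> bool}) : nat :=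
  ex_minn (computable_ex f).

Definition D (k n : nat) : nat :=
  \max_(f : {ffun ksubset n k -> bool}) query_complexity f.

Lemma D_le (k n : nat) : D k n <= n.
Proof.
apply/bigmax_leqP => f _; rewrite /query_complexity.
by case: ex_minnP => q _; apply; apply/asboolP/computable_within_n.
Qed.

(* The truncated subtraction is the true difference by [D_le]. *)
Definition E (k n : nat) : nat := n - D k n.

(* Main.v *)
Require Import Defs.
From mathcomp Require Import all_boot.
From mathcomp Require Import boolp zify.

Set Implicit Arguments.
Unset Strict Implicit.
Unset Printing Implicit Defensive.

(** Write m = k - k1, and split the ground set as [n - 2m] together with [2m].
    On the sets meeting the second part in exactly m points, consider the XOR
    of a hardest function on the slice (n - 2m, k1) with a hardest function on
    the balanced slice (2m, m).  Deterministic query complexity is additive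
    for XORs over disjoint ground sets, so
    D_k(n) >= D_k1(n - 2m) + D_m(2m), and it remains to bound D_m(2m) from
    below by 2m - 5.

    For this, let p(h, j) be the fraction of the functions on the slice (h, j)
    that can be computed with h - 6 queries.  Choosing the first query gives
    p(h, j) <= h p(h-1, j-1) p(h-1, j).  Applying this twice and using the
    trivial bound p <= 1 off the middle,
    p(2m, m) <= 2m (2m-1)^2 p(2m-2, m-1)^2,
    and since p(6, 3) = 2^-19 this keeps p(2m, m) < 1 for ever. *)

(** * Query algorithms on arbitrary families of sets, and counting easy functions *)

Definition computable_on n (X : {set {set 'I_n}}) (f : {set 'I_n} -> bool)
    (q : nat) : Prop :=
  exists t : algorithm n,
    forall A, A \in X -> run t A = f A /\ queries t A <= q.

Section ComputableOn.
Variable n : nat.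
Implicit Types (X Y : {set {set 'I_n}}) (f g : {set 'I_n} -> bool).

Definition with_elt (i : 'I_n) X := [set A in X | i \in A].
Definition without_elt (i : 'I_n) X := [set A in X | i \notin A].

Lemma with_eltP i X (A : {set 'I_n}) :
  reflect (A \in X /\ i \in A) (A \in with_elt i X).
Proof. by rewrite inE; apply: andP. Qed.

Lemma without_eltP i X (A : {set 'I_n}) :
  reflect (A \in X /\ i \notin A) (A \in without_elt i X).
Proof. by rewrite inE; apply: andP. Qed.

Lemma with_withoutU i X : with_elt i X :|: without_elt i X = X.
Proof. by apply/setP=> A; rewrite !inE; case: (i \in A); rewrite ?andbT ?andbF ?orbF. Qed.

Lemma card_with_without i X : #|with_elt i X| + #|without_elt i X| = #|X|.
Proof.
rewrite -[in RHS](with_withoutU i X) cardsU -[LHS]subn0; congr (_ - _).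
apply/esym/eqP; rewrite cards_eq0; apply/eqP/setP=> A; rewrite !inE.
by case: (i \in A); rewrite ?andbF.
Qed.

Lemma sub_computable_on X Y f q r :
  X \subset Y -> q <= r -> computable_on Y f q -> computable_on X f r.
Proof.
move=> /subsetP sXY leqr [t tP]; exists t => A /sXY /tP[-> le].
by split=> //; apply: leq_trans leqr.
Qed.

Lemma eq_computable_on X f g q :
  {in X, f =1 g} -> computable_on X f q -> computable_on X g q.
Proof. by move=> efg [t tP]; exists t => A AX; rewrite -efg //; apply: tP. Qed.

Lemma computable_on_const X f b q :
  {in X, forall A, f A = b} -> computable_on X f q.
Proof. by move=> fE; exists (Output b) => A /fE ->. Qed.

Lemma computable_on_query i X f q :
  computable_on (with_elt i X) f q -> computable_on (without_elt i X) f q ->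
  computable_on X f q.+1.
Proof.
move=> [t1 t1P] [t0 t0P]; exists (Query i t1 t0) => A AX /=.
case: ifPn => iA; first by apply/t1P/with_eltP.
by apply/t0P/without_eltP.
Qed.

(* A query outside [S] has the same answer on all of [X], hence is wasted. *)
Lemma computable_on_step X f q (S : {set 'I_n}) :
  S != set0 ->
  (forall i A A', i \notin S -> A \in X -> A' \in X -> (i \in A) = (i \in A')) ->
  computable_on X f q.+1 ->
  exists2 i, i \in S &
    computable_on (with_elt i X) f q /\ computable_on (without_elt i X) f q.
Proof.
move=> /set0Pn[s sS] fixX [t tP].
elim: t tP => [b|i t1 IH1 t0 IH0] /= tP.
  (* A leaf makes no query, so [f] is constant on [X] and any element of [S] serves. *)
  by exists s => //; split; apply: (@computable_on_const _ _ b) => A;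
     [move=> /with_eltP[]|move=> /without_eltP[]] => /tP[-> _].
have [iS|iNS] := boolP (i \in S).
  exists i => //; split; [exists t1 => A /with_eltP[]|exists t0 => A /without_eltP[]];
  by move=> /tP; case: ifP.
have [X0|[A0 A0X]] := set_0Vmem X; first by apply: IH1 => A; rewrite X0 inE.
have [iA0|iNA0] := boolP (i \in A0).
- by apply: IH1 => A AX; have := tP A AX; rewrite (fixX i A A0) // iA0 => -[-> /ltnW].
- apply: IH0 => A AX; have := tP A AX.
  by rewrite (fixX i A A0) // (negbTE iNA0) => -[-> /ltnW].
Qed.

(** A Boolean function on [X] is encoded as the subfamily [Y] where it is true, so that easy
    functions can be counted against [2 ^ #|X|]. *)
Definition easy X q : {set {set {set 'I_n}}} :=
  [set Y in powerset X | `[< computable_on X (fun A => A \in Y) q >]].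

Lemma card_easy_le X q : #|easy X q| <= 2 ^ #|X|.
Proof.
by rewrite -card_powerset; apply: subset_leq_card; apply/subsetP=> Y; rewrite inE => /andP[].
Qed.

Lemma card_easy0 X : #|easy X 0| <= 2.
Proof.
apply: (@leq_trans #|[set set0; X]|); last by rewrite cards2; case: eqP.
apply: subset_leq_card; apply/subsetP=> Y; rewrite !inE => /andP[/subsetP sYX /asboolP[t tP]].
(* A query would already exceed the budget 0, so then [X], and with it [Y], is empty. *)
case: t tP => [b|i t1 t0] tP; last first.
  apply/orP; left; apply/eqP/setP=> A; rewrite inE; apply: contraTF isT => /sYX.
  by move=> /tP[].
apply/orP; case: b tP => tP; [right|left]; apply/eqP/setP=> A; rewrite ?inE.
  by apply/idP/idP=> [/sYX|/tP[]].
by apply: contraTF isT => AY; have [] := tP A (sYX _ AY); rewrite AY.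
Qed.

(** An easy [Y] is determined by a useful first query [i] and its two restrictions by membership of
    [i], each easy with one query less; a union bound over [i] gives the sum. *)
Lemma card_easy_step X q (S : {set 'I_n}) :
  S != set0 ->
  (forall i A A', i \notin S -> A \in X -> A' \in X -> (i \in A) = (i \in A')) ->
  #|easy X q.+1| <=
    \sum_(i in S) #|easy (with_elt i X) q| * #|easy (without_elt i X) q|.
Proof.
move=> S0 fixX.
pose P i := setX (easy (with_elt i X) q) (easy (without_elt i X) q).
pose U i : {set {set {set 'I_n}}} := [set p.1 :|: p.2 | p in P i].
have leU : #|\bigcup_(i in S) U i| <= \sum_(i in S) #|U i|.
  elim/big_rec2: _ => [|i m V _ leV]; first by rewrite cards0.
  by rewrite cardsU; apply: leq_trans (leq_subr _ _) _; rewrite leq_add2l.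
apply: leq_trans (leq_trans leU _); last first.
  by apply: leq_sum => i _; rewrite -cardsX; apply: leq_imset_card.
apply: subset_leq_card; apply/subsetP=> Y; rewrite inE powersetE.
move=> /andP[sYX /asboolP /(computable_on_step S0 fixX)[i iS [c1 c0]]].
apply/bigcupP; exists i => //.
apply/imsetP; exists (with_elt i Y, without_elt i Y); last by rewrite with_withoutU.
rewrite in_setX /=; apply/andP; split; rewrite in_set powersetE; apply/andP; split.
- by apply/subsetP=> A /with_eltP[/(subsetP sYX) ? ?]; apply/with_eltP.
- apply/asboolP; apply: (eq_computable_on _ c1) => A /with_eltP[_ iA].
  by rewrite inE iA andbT.
- by apply/subsetP=> A /without_eltP[/(subsetP sYX) ? ?]; apply/without_eltP.
- apply/asboolP; apply: (eq_computable_on _ c0) => A /without_eltP[_ iA].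
  by rewrite inE iA andbT.
Qed.

End ComputableOn.

(** * Counting easy functions on slices *)

Section Slices.
Variable n : nat.
Implicit Types S B A : {set 'I_n}.

(* The slice of weight [j] on the unqueried elements [S], when [B] is the set
   of elements already known to belong to the unknown set. *)
Definition slice S B (j : nat) : {set {set 'I_n}} :=
  [set A : {set 'I_n} | (A :\: S == B) && (#|A :&: S| == j)].

Lemma slice_fixed S B j (i : 'I_n) A A' :
  i \notin S -> A \in slice S B j -> A' \in slice S B j -> (i \in A) = (i \in A').
Proof.
move=> iNS; rewrite !inE => /andP[/eqP eA _] /andP[/eqP eA' _].
by have := congr1 (fun C : {set 'I_n} => i \in C) (etrans eA (esym eA')); rewrite !inE iNS.
Qed.

Lemma with_elt_slice S B j i : i \in S -> i \notin B ->
  with_elt i (slice S B j.+1) = slice (S :\ i) (i |: B) j.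
Proof.
move=> iS iNB; apply/setP=> A; rewrite !inE.
have [iA|iNA] := boolP (i \in A); last first.
  rewrite andbF; apply/esym/negbTE; rewrite negb_and; apply/orP; left.
  apply/eqP=> /setP/(_ i); rewrite !inE eqxx iS /=.
  by rewrite (negbTE iNA).
have iAS : i \in A :&: S by rewrite inE iA.
rewrite andbT setIDA (cardsD1 i (A :&: S)) iAS add1n eqSS; congr (_ && _).
apply/eqP/eqP => /setP e; apply/setP=> x; have := e x; rewrite !inE.
- by case: eqP => [->|_] //=; rewrite iA.
- by case: eqP => [->|_] //=; rewrite iS (negbTE iNB).
Qed.

Lemma without_elt_slice S B j i : i \in S -> i \notin B ->
  without_elt i (slice S B j) = slice (S :\ i) B j.
Proof.
move=> iS iNB; apply/setP=> A; rewrite !inE.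
have [iA|iNA] := boolP (i \in A).
  rewrite andbF; apply/esym/negbTE; rewrite negb_and; apply/orP; left.
  by apply/eqP=> /setP/(_ i); rewrite !inE eqxx iS iA (negbTE iNB).
have e : A :&: (S :\ i) = A :&: S.
  by apply/setP=> x; rewrite !inE; case: eqP => [->|//]; rewrite (negbTE iNA).
have e' : A :\: (S :\ i) = A :\: S.
  by apply/setP=> x; rewrite !inE; case: eqP => [->|//]; rewrite (negbTE iNA) !andbF.
by rewrite andbT e e'.
Qed.

Lemma card_slice S B j : [disjoint S & B] -> #|slice S B j| = 'C(#|S|, j).
Proof.
move=> dSB; have SB x : x \in S -> (x \in B) = false by apply: disjointFr.
have inj : {in slice S B j &, injective (fun A => A :&: S)}.
  move=> A A'; rewrite !inE => /andP[/eqP eA _] /andP[/eqP eA' _] e.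
  by rewrite -(setID A S) -(setID A' S) e eA eA'.
rewrite -cards_draws -(card_in_imset inj); apply: eq_card => C.
rewrite [RHS]inE; apply/imsetP/andP => [[A + ->]|[sCS cC]].
  by rewrite inE subsetIr => /andP[].
have NC x : x \notin S -> (x \in C) = false.
  by move=> xNS; apply: contraNF xNS => /(subsetP sCS).
have e : C = (C :|: B) :&: S.
  apply/setP=> x; rewrite !inE; have [xS|xNS] := boolP (x \in S).
    by rewrite SB // orbF andbT.
  by rewrite andbF NC.
(* The known elements [B] are the only possible part outside [S]. *)
exists (C :|: B) => //; rewrite inE -e cC andbT; apply/eqP/setP=> x; rewrite !inE.
by have [xS|xNS] := boolP (x \in S); [rewrite SB | rewrite NC].
Qed.

(** A bound uniform in the first query turns the sum into a factor [#|S|]. The weight [w] stands for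
    the inverse of a fraction of easy functions and keeps everything free of division. *)
Lemma card_easy_slice_step S B j q w M : S != set0 -> [disjoint S & B] ->
  (forall i, i \in S ->
     #|easy (slice (S :\ i) (i |: B) j) q| * #|easy (slice (S :\ i) B j.+1) q| * w
     <= M) ->
  #|easy (slice S B j.+1) q.+1| * w <= #|S| * M.
Proof.
move=> S0 dSB H; rewrite -[leqRHS]sum_nat_const.
have le_sum := card_easy_step q S0 (@slice_fixed S B j.+1).
apply: leq_trans (leq_mul le_sum (leqnn w)) _.
rewrite big_distrl; apply: leq_sum => i iS.
have iNB : i \notin B by rewrite (disjointFr dSB).
by rewrite with_elt_slice // without_elt_slice //; apply: H.
Qed.

Lemma card_slice_step S B j i : i \in S -> [disjoint S & B] ->
  #|slice (S :\ i) (i |: B) j| + #|slice (S :\ i) B j.+1| = #|slice S B j.+1|.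
Proof.
move=> iS dSB; have iNB : i \notin B by rewrite (disjointFr dSB).
by rewrite -with_elt_slice // -without_elt_slice // card_with_without.
Qed.

Lemma disjoint_setU1_D1 S B i : [disjoint S & B] -> [disjoint S :\ i & i |: B].
Proof.
rewrite -!setI_eq0 => /eqP/setP d; apply/eqP/setP=> x; have := d x; rewrite !inE.
by case: eqP.
Qed.

Lemma disjoint_D1 S B i : [disjoint S & B] -> [disjoint S :\ i & B].
Proof. by apply: disjointWl; apply: subD1set. Qed.

(* [w m = 64 * (m + 4) ^ 3] is chosen such that
   [(2 * m + 8) * (2 * m + 7) ^ 2 * w m.+1 <= w m ^ 2]. *)
Lemma card_easy_middle m S B : #|S| = 2 * m + 6 -> [disjoint S & B] ->
  #|easy (slice S B m.+3) (2 * m)| * (64 * (m + 4) ^ 3) <= 2 ^ #|slice S B m.+3|.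
Proof.
elim: m S B => [|m IH] S B cS dSB.
  rewrite card_slice // cS muln0.
  apply: leq_trans (leq_mul (card_easy0 _) (leqnn _)) _.
  (* Two constant functions times the weight [64 * 4 ^ 3 = 2 ^ 12] give exactly [2 ^ 13]. *)
  have -> : 'C(2 * 0 + 6, 3) = 13 + 7 by [].
  by rewrite expnD; set a := 2 ^ 13; rewrite leq_pmulr.
set w := 64 * (m + 4) ^ 3 in IH.
have S0 : S != set0 by rewrite -card_gt0 cS; lia.
have cS' i : i \in S -> #|S :\ i| = 2 * m + 7.
  by move=> iS; have := cardsD1 i S; rewrite iS cS; lia.
have cS'' i j : i \in S -> j \in S :\ i -> #|S :\ i :\ j| = 2 * m + 6.
  by move=> iS jS; have := cardsD1 j (S :\ i); rewrite jS cS' //; lia.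
have S'0 i : i \in S -> S :\ i != set0 by move=> iS; rewrite -card_gt0 cS' //; lia.
(* After a first answer yes, a second answer no leads back to a middle slice, where [IH] applies;
   the other branch gets the trivial bound. In [H0] the roles are swapped. *)
have H1 i : i \in S -> #|easy (slice (S :\ i) (i |: B) m.+3) (2 * m).+1| * w <=
    (2 * m + 7) * 2 ^ #|slice (S :\ i) (i |: B) m.+3|.
  move=> iS; have d := disjoint_setU1_D1 i dSB; rewrite -(cS' i iS).
  apply: card_easy_slice_step => // [|j jS]; first exact: S'0.
  rewrite -(card_slice_step _ jS d) expnD -mulnA.
  apply: leq_mul (card_easy_le _ _) _; apply: IH; first exact: cS''.
  exact: disjoint_D1.
have H0 i : i \in S -> #|easy (slice (S :\ i) B m.+4) (2 * m).+1| * w <=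
    (2 * m + 7) * 2 ^ #|slice (S :\ i) B m.+4|.
  move=> iS; have d := disjoint_D1 i dSB; rewrite -(cS' i iS).
  apply: card_easy_slice_step => // [|j jS]; first exact: S'0.
  rewrite -(card_slice_step _ jS d) expnD mulnAC.
  apply: leq_mul _ (card_easy_le _ _); apply: IH; first exact: cS''.
  exact: disjoint_setU1_D1.
(* Each of the two branches of the first query contributes one factor [w]. *)
have H : #|easy (slice S B m.+4) (2 * m).+2| * w ^ 2 <=
    (2 * m + 8) * ((2 * m + 7) ^ 2 * 2 ^ #|slice S B m.+4|).
  have -> : 2 * m + 8 = #|S| by lia.
  apply: card_easy_slice_step => // i iS.
  rewrite -(card_slice_step _ iS dSB) expnD -!mulnn mulnACA [leqRHS]mulnACA.
  exact: leq_mul (H1 i iS) (H0 i iS).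
have le_w : (2 * m + 8) * (2 * m + 7) ^ 2 * (64 * (m.+1 + 4) ^ 3) <= w ^ 2.
  rewrite /w; nia.
have -> : 2 * m.+1 = (2 * m).+2 by lia.
have w_gt0 : 0 < (2 * m + 8) * (2 * m + 7) ^ 2 by rewrite muln_gt0 expn_gt0; lia.
rewrite -(leq_pmul2l w_gt0) mulnCA -[leqRHS]mulnA.
by apply: leq_trans H; apply: leq_mul.
Qed.

End Slices.

(** * Additivity of query complexity for XORs over disjoint ground sets *)

Section XorAdditivity.
Variables m n : nat.

Definition glue (A1 : {set 'I_m}) (A2 : {set 'I_n}) : {set 'I_(m + n)} :=
  (lshift n @: A1) :|: (@rshift m n @: A2).

Lemma lshift_glue i A1 A2 : (lshift n i \in glue A1 A2) = (i \in A1).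
Proof.
rewrite inE mem_imset; last exact: lshift_inj.
by case: imsetP => [[j _ /eqP]|_]; rewrite ?eq_lrshift ?orbF.
Qed.

Lemma rshift_glue i A1 A2 : (rshift m i \in glue A1 A2) = (i \in A2).
Proof.
rewrite inE orbC mem_imset; last exact: rshift_inj.
by case: imsetP => [[j _ /eqP]|_]; rewrite ?eq_rlshift ?orbF.
Qed.

Lemma card_glue A1 A2 : #|glue A1 A2| = #|A1| + #|A2|.
Proof.
rewrite cardsU !card_imset; [|exact: rshift_inj|exact: lshift_inj].
suff -> : (lshift n @: A1) :&: (@rshift m n @: A2) = set0 by rewrite cards0 subn0.
apply/setP=> x; rewrite !inE; apply/negbTE/negP=> /andP[/imsetP[i _ ->] /imsetP[j _ /eqP]].
by rewrite eq_lrshift.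
Qed.

Lemma glueK1 A1 A2 : lshift n @^-1: glue A1 A2 = A1.
Proof. by apply/setP=> i; rewrite inE lshift_glue. Qed.

Lemma glueK2 A1 A2 : @rshift m n @^-1: glue A1 A2 = A2.
Proof. by apply/setP=> i; rewrite inE rshift_glue. Qed.

(** Induction on [t]: a query in one half splits only the family of that half, so the general
    families [X1] and [X2] are what the induction needs. *)
Lemma xor_additive (t : algorithm (m + n)) X1 X2 f1 f2 q :
  X1 != set0 -> X2 != set0 ->
  (forall A1 A2, A1 \in X1 -> A2 \in X2 ->
    run t (glue A1 A2) = f1 A1 (+) f2 A2 /\ queries t (glue A1 A2) <= q) ->
  exists q1 q2, [/\ q1 + q2 <= q, computable_on X1 f1 q1 & computable_on X2 f2 q2].
Proof.
elim: t X1 X2 q => [b|i t1 IH1 t0 IH0] X1 X2 q X1n0 X2n0 /= tP.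
  (* At a leaf the XOR is constant; fixing one argument shows that the function of the other is
     constant too. *)
  have /set0Pn[A1 A1X] := X1n0; have /set0Pn[A2 A2X] := X2n0.
  exists 0, 0; split => //.
    apply: (@computable_on_const _ _ _ (b (+) f2 A2)) => A AX.
    by have [-> _] := tP _ _ AX A2X; rewrite addbK.
  apply: (@computable_on_const _ _ _ (b (+) f1 A1)) => A AX.
  by have [-> _] := tP _ _ A1X AX; rewrite addbC addKb.
case: q tP => [|q] tP.
  have /set0Pn[A1 A1X] := X1n0; have /set0Pn[A2 A2X] := X2n0.
  by have [] := tP _ _ A1X A2X.
case: (split_ordP i) tP => [j ->|j ->] tP.
- have P1 A1 A2 : A1 \in with_elt j X1 -> A2 \in X2 ->
      run t1 (glue A1 A2) = f1 A1 (+) f2 A2 /\ queries t1 (glue A1 A2) <= q.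
    by move=> /with_eltP[A1X jA] /(tP _ _ A1X); rewrite lshift_glue jA.
  have P0 A1 A2 : A1 \in without_elt j X1 -> A2 \in X2 ->
      run t0 (glue A1 A2) = f1 A1 (+) f2 A2 /\ queries t0 (glue A1 A2) <= q.
    by move=> /without_eltP[A1X jA] /(tP _ _ A1X); rewrite lshift_glue (negbTE jA).
  (* If one answer is impossible on [X1], the other branch already covers all of [X1]. *)
  have [e1|n1] := eqVneq (with_elt j X1) set0.
    have [e0|n0] := eqVneq (without_elt j X1) set0.
      by move: X1n0; rewrite -(with_withoutU j X1) e1 e0 setU0 eqxx.
    have [q1 [q2 [leq c1 c2]]] := IH0 _ _ _ n0 X2n0 P0.
    exists q1, q2; split; [exact: leqW|by rewrite -(with_withoutU j X1) e1 set0U|by []].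
  have [q1 [q2 [leq c1 c2]]] := IH1 _ _ _ n1 X2n0 P1.
  have [e0|n0] := eqVneq (without_elt j X1) set0.
    exists q1, q2; split; [exact: leqW|by rewrite -(with_withoutU j X1) e0 setU0|by []].
  have [r1 [r2 [leq' c1' c2']]] := IH0 _ _ _ n0 X2n0 P0.
  (* Either branch computes [f2] on the whole of [X2], so the pair is taken from the branch that is
     costlier on [X1]; its cost there, plus one for the query, covers both branches. *)
  have [le1|/ltnW le1] := leqP q1 r1.
    exists r1.+1, r2; split; [exact: leq' | |by []].
    apply: (@computable_on_query _ j) => //.
    exact: sub_computable_on (subxx _) le1 c1.
  exists q1.+1, q2; split; [exact: leq | |by []].
  apply: (@computable_on_query _ j) => //.
  exact: sub_computable_on (subxx _) le1 c1'.
- have P1 A1 A2 : A1 \in X1 -> A2 \in with_elt j X2 ->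
      run t1 (glue A1 A2) = f1 A1 (+) f2 A2 /\ queries t1 (glue A1 A2) <= q.
    by move=> A1X /with_eltP[/(tP _ _ A1X) + jA]; rewrite rshift_glue jA.
  have P0 A1 A2 : A1 \in X1 -> A2 \in without_elt j X2 ->
      run t0 (glue A1 A2) = f1 A1 (+) f2 A2 /\ queries t0 (glue A1 A2) <= q.
    by move=> A1X /without_eltP[/(tP _ _ A1X) + jA]; rewrite rshift_glue (negbTE jA).
  have [e1|n1] := eqVneq (with_elt j X2) set0.
    have [e0|n0] := eqVneq (without_elt j X2) set0.
      by move: X2n0; rewrite -(with_withoutU j X2) e1 e0 setU0 eqxx.
    have [q1 [q2 [leq c1 c2]]] := IH0 _ _ _ X1n0 n0 P0.
    exists q1, q2; split; [exact: leqW|by []|by rewrite -(with_withoutU j X2) e1 set0U].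
  have [q1 [q2 [leq c1 c2]]] := IH1 _ _ _ X1n0 n1 P1.
  have [e0|n0] := eqVneq (without_elt j X2) set0.
    exists q1, q2; split; [exact: leqW|by []|by rewrite -(with_withoutU j X2) e0 setU0].
  have [r1 [r2 [leq' c1' c2']]] := IH0 _ _ _ X1n0 n0 P0.
  have [le2|/ltnW le2] := leqP q2 r2.
    exists r1, r2.+1; split; [by rewrite addnS | by [] |].
    apply: (@computable_on_query _ j) => //.
    exact: sub_computable_on (subxx _) le2 c2.
  exists q1, q2.+1; split; [by rewrite addnS | by [] |].
  apply: (@computable_on_query _ j) => //.
  exact: sub_computable_on (subxx _) le2 c2'.
Qed.

End XorAdditivity.

(** * Lower bounds for [D] and the conclusion *)

Definition kslice n k : {set {set 'I_n}} :=
  [set A : {set 'I_n} | #|A| == k].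

Lemma kslice_neq0 n k : k <= n -> kslice n k != set0.
Proof. by move=> lekn; rewrite -card_gt0 card_draws card_ord bin_gt0. Qed.

Definition restrict n k (f : {set 'I_n} -> bool) : {ffun ksubset n k -> bool} :=
  [ffun A => f (val A)].

Lemma computable_within_restrict n k (f : {set 'I_n} -> bool) q :
  computable_within (restrict k f) q -> computable_on (kslice n k) f q.
Proof.
move=> [t tP]; exists t => A; rewrite inE => kA.
by have := tP (exist _ A kA); rewrite ffunE.
Qed.

(** The default [false] is taken only off the slice. *)
Definition extend n k (f : {ffun ksubset n k -> bool}) (A : {set 'I_n}) : bool :=
  if insub A is Some B then f B else false.

Lemma computable_on_extend n k (f : {ffun ksubset n k -> bool}) q :
  computable_on (kslice n k) (extend f) q -> computable_within f q.
Proof.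
move=> [t tP]; exists t => A; have := tP (val A).
by rewrite inE /extend (valP A) valK => /(_ isT).
Qed.

Lemma query_complexity_min n k (f : {ffun ksubset n k -> bool}) q :
  computable_within f q -> query_complexity f <= q.
Proof. by move=> /asboolP fq; rewrite /query_complexity; case: ex_minnP => r _; apply. Qed.

Lemma D_ge n k d (f : {set 'I_n} -> bool) :
  (forall q, computable_on (kslice n k) f q -> d <= q) -> d <= D k n.
Proof.
move=> fP; apply: (@leq_trans (query_complexity (restrict k f))).
  rewrite /query_complexity; case: ex_minnP => q /asboolP fq _.
  exact/fP/computable_within_restrict.
exact: (leq_bigmax (F := fun f => query_complexity f)).
Qed.

Lemma D_attained k n : exists f : {set 'I_n} -> bool,
  forall q, computable_on (kslice n k) f q -> D k n <= q.
Proof.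
have [|f fE] := @eq_bigmax _ (fun f : {ffun ksubset n k -> bool} => query_complexity f).
  (* A maximum is attained over a nonempty index type. *)
  by apply/card_gt0P; exists [ffun=> false].
exists (extend f) => q /computable_on_extend fq.
by rewrite /D fE; apply: query_complexity_min.
Qed.

(** A [j]-set glued to a [k]-set lies in the slice of weight [j + k], so an algorithm for the XOR of
    two hardest functions on that slice can be split by [xor_additive]. *)
Lemma D_add m n j k : j <= m -> k <= n -> D j m + D k n <= D (j + k) (m + n).
Proof.
move=> lejm lekn; have [f1 f1P] := D_attained j m; have [f2 f2P] := D_attained k n.
pose f (A : {set 'I_(m + n)}) :=
  f1 (lshift n @^-1: A) (+) f2 (@rshift m n @^-1: A).
apply: (@D_ge _ _ _ f) => q [t tP].
have [A1 A2|q1 [q2 [leq c1 c2]]] := @xor_additive m n t (kslice m j) (kslice n k) f1 f2 q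
    (kslice_neq0 lejm) (kslice_neq0 lekn) _.
  rewrite !inE => /eqP cA1 /eqP cA2; have := tP (glue A1 A2).
  by rewrite inE card_glue cA1 cA2 eqxx /f glueK1 glueK2 => /(_ isT).
by apply: leq_trans leq; apply: leq_add; [apply: f1P|apply: f2P].
Qed.

Lemma D_middle m : 2 * m - 5 <= D m (2 * m).
Proof.
(* Below 3 the truncated subtraction makes the bound trivial; from 3 on, [card_easy_middle]
   applies. *)
case: (ltnP m 3) => [lt3|le3]; first by have -> : 2 * m - 5 = 0 by lia.
have [k {le3}->] : exists k, m = k.+3 by exists (m - 3); lia.
set n := 2 * k.+3; have d0 : [disjoint [set: 'I_n] & set0] by rewrite -setI_eq0 setI0.
have cT : #|[set: 'I_n]| = 2 * k + 6 by rewrite cardsT card_ord; lia.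
have sliceE : slice [set: 'I_n] set0 k.+3 = kslice n k.+3.
  by apply/setP=> A; rewrite !inE setDT eqxx setIT.
have := card_easy_middle cT d0; rewrite sliceE.
set w := 64 * _ => cP.
have lt_easy : #|easy (kslice n k.+3) (2 * k)| < #|powerset (kslice n k.+3)|.
  (* As the weight exceeds 1, the easy functions are strictly fewer than all functions, so some [Y]
     defeats [2 * k] queries. *)
  rewrite card_powerset; have w1 : 1 < w by rewrite /w; have := expn_gt0 (k + 4) 3; lia.
  have [->|e0] := posnP #|easy (kslice n k.+3) (2 * k)|; first by rewrite expn_gt0.
  by apply: leq_trans cP; rewrite -[ltnLHS]muln1 ltn_pmul2l.
have [Y sY hardY] : exists2 Y : {set {set 'I_n}}, Y \in powerset (kslice n k.+3) &
    Y \notin easy (kslice n k.+3) (2 * k).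
  apply/subsetPn; apply: contraL lt_easy => /subset_leq_card.
  by rewrite -leqNgt.
have -> : n - 5 = (2 * k).+1 by lia.
apply: (@D_ge _ _ _ (fun A => A \in Y)) => q Yq.
rewrite ltnNge; apply: contra hardY => leq; rewrite in_set sY /=.
apply/asboolP; exact: sub_computable_on (subxx _) leq Yq.
Qed.

Unset Implicit Arguments.

Theorem corollary1p5 (n k k1 : nat) (hk1 : k1 <= k) (hk : 2 * k <= n) :
  E k n <= E k1 (n - 2 * (k - k1)) + 7.
Proof.
(* The loss against [E k1] is at most the deficit 5 of [D_middle], which is within 7. [D_le] makes
   the subtraction in [E k1] a true difference. *)
have := @D_add (n - 2 * (k - k1)) (2 * (k - k1)) k1 (k - k1).
have := D_middle (k - k1); have := D_le k1 (n - 2 * (k - k1)).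
rewrite subnK ?subnKC /E; lia.
Qed.
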